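(* Assume that for every $w\in\mathcal W$ the loss $\ell(w,Z)$, $Z\sim P_Z$, is $\sigma$-sub-Gaussian, and that for every $z\in\mathcal Z$ the map $w\mapsto \ell(w,z)$ is $K$-Lipschitz with respect to $d_{\mathcal W}$. Fix any data-independent probability distribution $Q_{W'W}$ on $\mathcal W\times\mathcal W$, any $k>0$ and any $\epsilon\in(0,1)$. Then with probability at least $1-\epsilon$ over $S\sim P_Z^{n}$, $$\Delta\le \frac{k\sigma^2}{2n}+\frac{D(P_{W'W|S}\,\|\,Q_{W'W})-\log\epsilon}{k}+\frac1k\log \mathbb E_{(W',W)\sim Q_{W'W}}\Big[e^{kK\,d_{\mathcal W}(W',W)}\Big].$$
   Context: Setting. Let $\mathcal Z=\mathcal X\times\mathcal Y$ be an instance space with data distribution $P_Z$, and let $S=(Z_1,\dots,Z_n)\sim P_Z^{n}$ be a training set of $n$ i.i.d. samples. An augmented network has $L+1$ layers with weights $W=(W^{(1)},\dots,W^{(L+1)})\in\mathcal W=\mathcal W^{(1)}\times\cdots\times\mathcal W^{(L+1)}$. A distinguished index $l_0$ is the channel layer: $\mathcal W^{(l_0)}=\mathbb R^{d\times d}\times\mathbb R^{d}$, with weights $W^{(l_0)}=(M^{(l_0)},B^{(l_0)})$ acting on a feature $f\in\mathbb R^d$ by $f\mapsto M^{(l_0)}f+B^{(l_0)}$. The other weights $\tilde W=(W^{(l)})_{l\ne l_0}\in\tilde{\mathcal W}=\prod_{l\neq l_0}\mathcal W^{(l)}$ are the learnable weights. A learning algorithm is a Markov kernel $P_{\tilde W|S}$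 from $\mathcal Z^n$ to $\tilde{\mathcal W}$; the channel-free training distribution on $\mathcal W$ is $P_{W|S}=P_{\tilde W|S}\otimes\delta_{(\mathbf I_d,\mathbf 0)}$ (channel layer fixed to identity matrix and zero bias). A channel is a Markov kernel $P_{W'^{(l_0)}|W^{(l_0)}}$ on $\mathcal W^{(l_0)}$; the deployment kernel $P_{W'|W}$ sets $W'^{(l)}=W^{(l)}$ for all $l\ne l_0$ and draws $W'^{(l_0)}\sim P_{W'^{(l_0)}|W^{(l_0)}}(\cdot\,|\,W^{(l_0)})$ independently of everything else. The joint distribution on $\mathcal W\times\mathcal W$ is $P_{W'W|S}(W',W|S)=P_{W'|W}(W'|W)P_{W|S}(W|S)$, and $P_{W'|S}$ denotes its marginal in $W'$. For a loss $\ell:\mathcal W\times\mathcal Z\to[0,\infty)$ let $L(w)=\mathbb E_{Z\sim P_Z}[\ell(w,Z)]$ and $\hat L(w,S)=\frac1n\sum_{i=1}^n\ell(w,Z_i)$; for a distribution $P$ on $\mathcal W$, $L(P)=\int L(w)P(dw)$ and $\hat L_S(P)=\int\hat L(w,S)P(dw)$. The wireless generalization error is $\Delta=L(P_{W'|S})-\hat L_S(P_{W|S})$. The metric on $\mathcal W$ is $d_{\mathcal W}(W',W)=\sum_{l=1}^{L+1}d^{(l)}(W'^{(l)},W^{(l)})$ where each $d^{(l)}$ is a metric on $\mathcal W^{(l)}$. ''$\sigma$-sub-Gaussian'' means $\log\mathbb E[e^{\lambda(\ell(w,Z)-L(w))}]\le\lambda^2\sigma^2/2$ for all $\lambda\in\mathbb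 R$; ''$K$-Lipschitz'' means $|\ell(w,z)-\ell(w',z)|\le K\,d_{\mathcal W}(w,w')$. ''Data-independent'' means not depending on $S$. $D(\cdot\|\cdot)$ is the Kullback–Leibler divergence (natural logarithm). *)

(* Defs.v *)
From HB Require Import structures.
From mathcomp Require Import all_boot all_order all_algebra.
From mathcomp Require Import all_classical all_reals all_analysis.
Set Implicit Arguments. Unset Strict Implicit. Unset Printing Implicit Defensive.
Import Order.TTheory GRing.Theory Num.Theory.
Local Open Scope classical_set_scope.
Local Open Scope ring_scope.
Local Open Scope ereal_scope.

(* Extended-real natural logarithm (used for log of expectations of positive
   quantities, which may be +oo). *)
Definition eln (R : realType) (x : \bar R) : \bar R :=
  match x with
  | r%:E => (ln r)%:E
  | +oo => +oo
  | -oo => -oo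
  end.

Definition is_density d (T : measurableType d) (R : realType)
  (P Q : set T -> \bar R) (f : T -> R) : Prop :=
  [/\ measurable_fun [set: T] f, (forall x, (0 <= f x)%R) &
      forall A, measurable A -> P A = \int[Q]_(x in A) (f x)%:E].

Definition KL d (T : measurableType d) (R : realType)
  (P Q : set T -> \bar R) : \bar R :=
  match pselect (exists f : T -> R, is_density P Q f) with
  | left h => \int[P]_x (ln (sval (cid h) x))%:E
  | right _ => +oo
  end.

Definition is_product_prob d (Z : measurableType d) (R : realType)
  (PZ : probability Z R) (n : nat) (Pn : probability (n.-tuple Z) R) : Prop :=
  forall A : 'I_n -> set Z, (forall i, measurable (A i)) ->
    Pn [set s | forall i, A i (tnth s i)] = \prod_(i < n) PZ (A i).

Definition is_metric (T : Type) (R : realType) (m : T -> T -> R) : Prop :=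
  [/\ forall x y, (0 <= m x y)%R, forall x y, m x y = 0%R <-> x = y,
      forall x y, m x y = m y x & forall x y z, (m x z <= m x y + m y z)%R].

(* The channel layer space R^{d x d} x R^d: a d x d matrix is stored as the
   d-tuple of its rows, the bias as a d-tuple. *)
Notation chan_space R d := (d.-tuple (d.-tuple R) * d.-tuple R)%type (only parsing).

Definition chan_id (R : realType) (d : nat) : chan_space R d :=
  ([tuple [tuple (i == j)%:R | j < d] | i < d], [tuple 0%R | _ < d]).

(* Full weight space W = (learnable weights) x (channel layer) *)
Notation wspace Wt R dd := (Wt * chan_space R dd)%type (only parsing).

Definition poprisk dZ (Z : measurableType dZ) (R : realType) (W : Type)
  (PZ : probability Z R) (loss : W -> Z -> R) (w : W) : \bar R :=
  \int[PZ]_z (loss w z)%:E.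

Definition emprisk dZ (Z : measurableType dZ) (R : realType) (W : Type) (n : nat)
  (loss : W -> Z -> R) (S : n.-tuple Z) (w : W) : \bar R :=
  ((n%:R)^-1 * \sum_(i < n) loss w (tnth S i))%:E.

Definition subgaussian_loss dZ (Z : measurableType dZ) (R : realType) (W : Type)
  (PZ : probability Z R) (loss : W -> Z -> R) (sigma : R) : Prop :=
  forall w, PZ.-integrable [set: Z] (fun z => (loss w z)%:E) /\
    forall lam : R,
      eln (\int[PZ]_z (expR (lam * (loss w z - fine (poprisk PZ loss w))))%:E)
        <= (lam ^+ 2 * sigma ^+ 2 / 2)%:E.

Definition lipschitz_loss (W Z : Type) (R : realType) (loss : W -> Z -> R)
  (dW : W -> W -> R) (K : R) : Prop :=
  forall z w w', (`|loss w z - loss w' z| <= K * dW w w')%R.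

Definition wmetric (Wt C : Type) (R : realType) (dt : Wt -> Wt -> R) (dc : C -> C -> R)
  (w' w : Wt * C) : R := (dt w'.1 w.1 + dc w'.2 w.2)%R.

Section Channel.
Context (R : realType) (dt : measure_display) (Wt : measurableType dt)
  (dZ : measure_display) (Z : measurableType dZ) (n dd : nat)
  (PWt : R.-pker (n.-tuple Z) ~> Wt)
  (chan : R.-pker (chan_space R dd) ~> (chan_space R dd)).

(* joint distribution P_{W'W|S} = P_{W'|W} P_{W|S}, with
   P_{W|S} = P_{Wt|S} (x) delta_{(I,0)} and the deployment kernel that keeps the
   learnable weights and draws the channel layer from chan((I,0)) *)
Definition joint_dist (S : n.-tuple Z) (A : set (wspace Wt R dd * wspace Wt R dd))
  : \bar R :=
  \int[PWt S]_wt \int[chan (chan_id R dd)]_c'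
     (\1_A ((wt, c'), (wt, chan_id R dd)) : R)%:E.

Definition deployed_risk (PZ : probability Z R) (loss : wspace Wt R dd -> Z -> R)
  (S : n.-tuple Z) : \bar R :=
  \int[PWt S]_wt \int[chan (chan_id R dd)]_c' poprisk PZ loss (wt, c').

Definition training_risk (loss : wspace Wt R dd -> Z -> R) (S : n.-tuple Z) : \bar R :=
  \int[PWt S]_wt emprisk loss S (wt, chan_id R dd).

End Channel.

(* Main.v *)
(* Donsker-Varadhan is applied, under Q, to [k (L(w') - Lhat(w, S))], which by
   the Lipschitz condition is at most [k (L(w') - Lhat(w', S)) + k K d(w', w)].
   Under the product measure the exponential moment of the first summand
   factors over the samples and is at most [exp (k^2 sigma^2 / 2n)]; exchanging
   the integrals and applying Markov's inequality to
   [S |-> E_Q exp (k (L(w') - Lhat(w, S)))] gives the bound with probability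
   [1 - eps].  When the training risk is [+oo] the left-hand side is [-oo],
   since [+oo - +oo = -oo] in [\bar R]. *)

Require Import Defs.
From HB Require Import structures.
From mathcomp Require Import all_boot all_order all_algebra.
From mathcomp Require Import all_classical all_reals all_analysis.
From mathcomp Require Import measurable_realfun ring lra.
Import Order.TTheory GRing.Theory Num.Theory.
Local Open Scope classical_set_scope.
Local Open Scope ring_scope.
Local Open Scope ereal_scope.

(** * Integrals against densities and the variational inequality *)

Section eq_setfun_integral.
Import HBNNSimple.

(** Simple functions evaluate the set function only on measurable level sets. This lets integrals
    against the bare set function [joint_dist] be computed with a genuine probability. *)
Lemma eq_setfun_integral d (T : measurableType d) (R : realType)
    (m1 m2 : set T -> \bar R) (f : T -> \bar R) :
  (forall A, measurable A -> m1 A = m2 A) ->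
  \int[m1]_x f x = \int[m2]_x f x.
Proof.
move=> m12; rewrite /integral.
have E (h : {nnsfun T >-> R}) : sintegral m1 h = sintegral m2 h.
  by apply: eq_fsbigr => r _; rewrite m12.
by congr (ereal_sup _ - ereal_sup _); apply/seteqP; split => _ [h hf <-];
  exists h.
Qed.

End eq_setfun_integral.

(** A density forces [P] to be dominated by [Q], and [f] has the same integrals over measurable sets
    as the Radon-Nikodym derivative, hence equals it [Q]-almost everywhere. Change of variables then
    transfers to [f]. *)
Lemma density_integral d (T : measurableType d) (R : realType)
    (P Q : probability T R) (f h : T -> R) :
  is_density P Q f -> measurable_fun [set: T] h -> (forall x, (0 <= h x)%R) ->
  \int[P]_x (h x)%:E = \int[Q]_x (h x * f x)%:E.
Proof.
move=> [mf f0 Pf] mh h0.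
have PQ : P `<< Q.
  apply/null_content_dominatesP => A mA QA0; rewrite Pf//.
  apply: null_set_integral => //.
  by apply/measurable_EFinP; exact: measurable_funTS.
have mhE : measurable_fun [set: T] (EFin \o h) by exact/measurable_EFinP.
rewrite -(Radon_Nikodym_SigmaFinite.change_of_variables PQ (f := EFin \o h))//.
have Ig := Radon_Nikodym_SigmaFinite.f_integrable PQ.
under [RHS]eq_integral do rewrite EFinM.
apply: ae_eq_integral => //.
- apply: emeasurable_funM => //; exact: measurable_int Ig.
- by apply: emeasurable_funM => //; exact/measurable_EFinP.
apply: ae_eqe_mul2l; apply: integral_ae_eq => //; first exact/measurable_EFinP.
by move=> E _ mE; rewrite -Pf// -Radon_Nikodym_SigmaFinite.f_integral.
Qed.

(* Strict when [f] vanishes on a set of positive [Q]-measure; there [ln 0 = 0]. *)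
Lemma le_integral_expR_ln_density d (T : measurableType d) (R : realType)
    (P Q : probability T R) (f g : T -> R) :
  is_density P Q f -> measurable_fun [set: T] g ->
  \int[P]_x (expR (g x - ln (f x)))%:E <= \int[Q]_x (expR (g x))%:E.
Proof.
move=> fPQ mg; have [mf f0 _] := fPQ.
have mgf : measurable_fun [set: T] (fun x => expR (g x - ln (f x))).
  apply: measurableT_comp => //; apply: measurable_funB => //.
  exact: measurableT_comp.
rewrite (density_integral _ _ _ _ _ _ _ fPQ)//.
apply: ge0_le_integral => //.
- by move=> x _; rewrite lee_fin mulr_ge0// expR_ge0.
- exact/measurable_EFinP/measurable_funM.
- exact/measurable_EFinP/measurableT_comp.
- move=> x _; rewrite lee_fin; have [->|fx] := eqVneq (f x) 0%R.
    by rewrite mulr0 expR_ge0.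
  by rewrite expRB lnK ?divfK// posrE lt_def fx f0.
Qed.

Lemma ge0_EFin_integrable d (T : measurableType d) (R : realType)
    (mu : {measure set T -> \bar R}) (h : T -> R) :
  measurable_fun [set: T] h -> (forall x, (0 <= h x)%R) ->
  \int[mu]_x (h x)%:E < +oo -> mu.-integrable [set: T] (EFin \o h).
Proof.
move=> mh h0 hoo; apply/integrableP; split; first exact/measurable_EFinP.
by under eq_integral do rewrite /= ger0_norm//.
Qed.

(** The negative part of [ln f] is at most [expR (- ln f)], whose [P]-integral is at most the total
    [Q]-mass, namely 1. *)
Lemma density_ln_neg_lty d (T : measurableType d) (R : realType)
    (P Q : probability T R) (f : T -> R) :
  is_density P Q f -> \int[P]_x (fun x => (ln (f x))%:E)^\- x < +oo.
Proof.
move=> fPQ; have [mf f0 _] := fPQ.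
have mlnf : measurable_fun [set: T] (fun x => ln (f x)).
  exact: measurableT_comp.
apply: (@le_lt_trans _ _ (\int[P]_x (expR (0 - ln (f x)))%:E)); last first.
  apply: le_lt_trans
    (le_integral_expR_ln_density _ _ _ _ _ _ (cst 0%R) fPQ _) _ => //=.
  by rewrite expR0 integral_cst//= probability_setT mule1 ltry.
apply: ge0_le_integral => //.
- exact/measurable_funeneg/measurable_EFinP.
- apply/measurable_EFinP; apply: measurableT_comp => //.
  exact: measurable_funB.
- move=> x _; rewrite funenegE /= -EFin_max lee_fin ge_max expR_ge0 andbT.
  by rewrite sub0r; have := expR_ge1Dx (- ln (f x)); lra.
Qed.

Lemma density_ln_gtNy d (T : measurableType d) (R : realType)
    (P Q : probability T R) (f : T -> R) :
  is_density P Q f -> -oo < \int[P]_x (ln (f x))%:E.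
Proof.
move=> fPQ; rewrite integralE.
have := density_ln_neg_lty _ _ _ _ _ _ fPQ.
have : 0 <= \int[P]_x (fun x => (ln (f x))%:E)^\+ x by exact: integral_ge0.
by case: (integral _ _ _) => // [r|] _; case: (integral _ _ _) => //= s _;
  rewrite ltNyr.
Qed.

(** The negative part always has a finite integral, so a finite upper bound on the difference bounds
    the positive part too. *)
Lemma density_ln_integrable d (T : measurableType d) (R : realType)
    (P Q : probability T R) (f : T -> R) :
  is_density P Q f -> \int[P]_x (ln (f x))%:E < +oo ->
  P.-integrable [set: T] (fun x => (ln (f x))%:E).
Proof.
move=> fPQ lnoo; have [mf f0 _] := fPQ.
have mln : measurable_fun [set: T] (fun x => (ln (f x))%:E).
  by apply/measurable_EFinP; exact: measurableT_comp.
apply/integrableP; split => //.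
rewrite -[fun x => _]/(abse \o (fun x => (ln (f x))%:E)) fune_abse.
rewrite ge0_integralD//; [|exact: measurable_funepos|exact: measurable_funeneg].
have negoo := density_ln_neg_lty _ _ _ _ _ _ fPQ.
apply: lte_add_pinfty => //.
rewrite integralE in lnoo; move: lnoo.
have : 0 <= \int[P]_x (fun x => (ln (f x))%:E)^\- x by exact: integral_ge0.
case: (integral _ _ (_^\-)) negoo => // q _ _.
by rewrite lteBlDr// => /lt_le_trans; apply.
Qed.

(* With [u = exp (a - b - c - ln f)], the inequality [1 + t <= exp t] gives
   [a <= b + c + ln f - 1 + u] pointwise, and [\int[P] u <= 1]. *)
Lemma density_variational d (T : measurableType d) (R : realType)
    (P Q : probability T R) (f a b : T -> R) (c : R) :
  is_density P Q f -> \int[P]_x (ln (f x))%:E < +oo ->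
  measurable_fun [set: T] a -> measurable_fun [set: T] b ->
  (forall x, (0 <= a x)%R) -> (forall x, (0 <= b x)%R) ->
  \int[P]_x (b x)%:E < +oo ->
  \int[Q]_x (expR (a x - b x - c))%:E <= 1 ->
  \int[P]_x (a x)%:E <=
    \int[P]_x (b x)%:E + (c%:E + \int[P]_x (ln (f x))%:E).
Proof.
move=> fPQ lnoo ma mb a0 b0 boo abc; have [mf f0 _] := fPQ.
pose u x := expR (a x - b x - c - ln (f x)).
have mabc : measurable_fun [set: T] (fun x => a x - b x - c)%R.
  by apply: measurable_funB => //; exact: measurable_funB.
have mu : measurable_fun [set: T] u.
  apply: measurableT_comp => //; apply: measurable_funB => //.
  exact: measurableT_comp.
have u1 : \int[P]_x (u x)%:E <= 1.
  exact: le_trans (le_integral_expR_ln_density _ _ _ _ _ _ _ fPQ mabc) abc.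
have Iln := density_ln_integrable _ _ _ _ _ _ fPQ lnoo.
have Ib := ge0_EFin_integrable _ _ _ P _ mb b0 boo.
have Iu : P.-integrable [set: T] (EFin \o u).
  apply: ge0_EFin_integrable => //; last exact: le_lt_trans u1 (ltry _).
  by move=> x; exact: expR_ge0.
have Ic : P.-integrable [set: T] (EFin \o cst (c - 1)%R).
  exact: finite_measure_integrable_cst.
(* An integrable majorant of [a]. As [a] is nonnegative, monotonicity of the integral applies
   without knowing beforehand that [a] is integrable. *)
pose r x := (b x)%:E + (((c - 1)%:E + (u x)%:E) + (ln (f x))%:E).
have Icu := integrableD measurableT Ic Iu.
have Icul := integrableD measurableT Icu Iln.
have Ir : P.-integrable [set: T] r := integrableD measurableT Ib Icul.
have Er : \int[P]_x r x = \int[P]_x (b x)%:E +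
    (((c - 1)%:E + \int[P]_x (u x)%:E) + \int[P]_x (ln (f x))%:E).
  rewrite integralD// integralD// integralD// integral_cst//=.
  by rewrite probability_setT mule1.
apply: (@le_trans _ _ (\int[P]_x r x)); last first.
  rewrite Er; apply: leeD2l; apply: leeD2r.
  have -> : c%:E = (c - 1)%:E + 1 by rewrite -EFinD subrK.
  exact: leeD2l.
have ar x : (a x)%:E <= r x.
  rewrite /r -!EFinD lee_fin.
  by have := expR_ge1Dx (a x - b x - c - ln (f x))%R; rewrite -/(u x); lra.
apply: ge0_le_integral => //.
- by move=> x _; rewrite lee_fin.
- exact/measurable_EFinP.
- exact: measurable_int Ir.
Qed.

(** Replaces the set function [m] by the probability [P]. The density is the one selected inside
    [KL], so independence of that choice is not at stake. *)
Lemma KL_density d (T : measurableType d) (R : realType)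
    (m : set T -> \bar R) (P Q : probability T R) :
  (forall A, measurable A -> m A = P A) ->
  KL m Q = +oo \/
  exists2 f, is_density P Q f & KL m Q = \int[P]_x (ln (f x))%:E.
Proof.
move=> mP; rewrite /KL; case: pselect => [h|_]; [right|by left].
case: cid => /= f [mf f0 mf']; exists f; last exact: eq_setfun_integral.
by split => // A mA; rewrite -mP// mf'.
Qed.

(** * Integrals of products under the product measure *)

Section product_prob.
Import HBNNSimple numFieldNormedType.Exports.
Context (dZ : measure_display) (Z : measurableType dZ) (R : realType)
  (PZ : probability Z R) (n : nat) (PZn : probability (n.-tuple Z) R)
  (PZnE : is_product_prob PZ PZn).

Lemma measurable_tuple_rect (A : 'I_n -> set Z) :
  (forall i, measurable (A i)) ->
  measurable [set s : n.-tuple Z | forall i, A i (tnth s i)].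
Proof.
move=> mA.
rewrite [X in measurable X](_ : _ =
    \bigcap_(i in [set: 'I_n]) ((@tnth n Z)^~ i @^-1` A i)); last first.
  by apply/seteqP; split => [s As i _ /=|s As i]; [exact: As|exact: (As i I)].
apply: fin_bigcap_measurable => // i _.
by rewrite -[X in measurable X]setTI; exact: measurable_tnth.
Qed.

(** A product of coordinate indicators is the indicator of a rectangle, where [is_product_prob]
    prescribes the measure. *)
Lemma integral_prod_indic (A : 'I_n -> set Z) :
  (forall i, measurable (A i)) ->
  \int[PZn]_s (\prod_(i < n) (\1_(A i) (tnth s i) : R))%:E =
  (\prod_(i < n) fine (PZ (A i)))%:E.
Proof.
move=> mA; transitivity (PZn [set s | forall i, A i (tnth s i)]).
  rewrite -[X in PZn X]setIT -integral_indic//; last exact: measurable_tuple_rect.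
  apply: eq_integral => s _; congr (_%:E).
  rewrite indicE; have [/[!inE] sA|] := boolP (s \in _).
    by rewrite big1// => i _; rewrite indicE mem_set//; exact: sA.
  rewrite notin_setE/= -existsNE => -[i Ai].
  by rewrite (bigD1 i)//= indicE memNset// mul0r.
rewrite PZnE// -prodEFin; apply: eq_bigr => i _.
by rewrite fineK// fin_num_measure.
Qed.

(** Writing [g] as a finite combination of indicators and distributing the product over the sum
    turns both sides into sums over maps [F] from coordinates to values of [g]; the terms match by
    the rectangle case. *)
Lemma integral_prod_nnsfun (g : {nnsfun Z >-> R}) :
  \int[PZn]_s (\prod_(i < n) g (tnth s i))%:E =
  ((fine (\int[PZ]_z (g z)%:E)) ^+ n)%:E.
Proof.
(* [r] lists the finitely many values of [g], and [A j] is the level set of the value [a j]. *)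
pose r : seq R := finmap.enum_fset (fset_set (range g)).
pose a (j : 'I_(size r)) : R := nth 0%R r j.
pose A (j : 'I_(size r)) : set Z := g @^-1` [set a j].
have gE z : g z = (\sum_(j < size r) a j * \1_(A j) z)%R.
  rewrite fimfunE fsbig_finite//= (big_nth 0%R) big_mkord.
  by apply: eq_bigr => j _.
have mA j : measurable (A j) by exact: measurable_sfunP.
have a0 j : (0 <= a j)%R.
  have : a j \in r by rewrite mem_nth.
  by rewrite in_fset_set// inE => -[z _ <-].
have mtn i : measurable_fun [set: n.-tuple Z] (fun s => @tnth n Z s i).
  exact: measurable_tnth.
have intg : \int[PZ]_z (g z)%:E = (\sum_(j < size r) a j * fine (PZ (A j)))%:E.
  under eq_integral do rewrite gE -sumEFin.
  rewrite ge0_integral_sum//; last 2 first.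
  - by move=> j; apply/measurable_EFinP/measurable_funM => //; exact: measurable_indic.
  - by move=> j z _; rewrite lee_fin mulr_ge0.
  rewrite -sumEFin; apply: eq_bigr => j _.
  under eq_integral do rewrite EFinM.
  rewrite ge0_integralZl_EFin//; last exact/measurable_EFinP/measurable_indic.
  by rewrite integral_indic// setIT EFinM fineK// fin_num_measure.
(* Reading the [n]-th power as a product over ['I_n] allows the right-hand side to be distributed as
   well. *)
rewrite intg /= -[X in (_ ^+ X)%R]card_ord -prodr_const bigA_distr_bigA/=.
under eq_integral.
  move=> s _; under eq_bigr do rewrite gE.
  rewrite bigA_distr_bigA/= -sumEFin.
  under eq_bigr do rewrite big_split/= EFinM.
  over.
have mp (F : {ffun 'I_n -> 'I_(size r)}) : measurable_fun [set: n.-tuple Z]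
    (fun s => (\prod_(i < n) (\1_(A (F i)) (tnth s i) : R))%:E).
  apply/measurable_EFinP; apply: measurable_prod => i _.
  have mI : measurable_fun [set: Z] (\1_(A (F i)) : Z -> R) by exact: measurable_indic.
  exact: (measurableT_comp mI (mtn i)).
have p0 (F : {ffun 'I_n -> 'I_(size r)}) s :
    0 <= (\prod_(i < n) (\1_(A (F i)) (tnth s i) : R))%:E.
  by rewrite lee_fin; apply: prodr_ge0 => i _; rewrite indicE ler0n.
have q0 (F : {ffun 'I_n -> 'I_(size r)}) : (0 <= \prod_(i < n) a (F i))%R.
  by apply: prodr_ge0 => i _; exact: a0.
rewrite /= ge0_integral_sum//; last 2 first.
- by move=> F; exact: emeasurable_funM.
- by move=> F s _; apply: mule_ge0; [rewrite lee_fin; exact: q0|exact: p0].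
rewrite -sumEFin; apply: eq_bigr => F _.
rewrite ge0_integralZl_EFin// integral_prod_indic//.
by rewrite -EFinM -big_split.
Qed.

(** Simple functions [g m] increase to [h]. Each has integral at most [M], so its product has
    integral at most [M ^+ n], and monotone convergence passes this to [h]. *)
Lemma integral_prod_le (h : Z -> R) (M : R) :
  measurable_fun [set: Z] h -> (forall z, (0 <= h z)%R) ->
  \int[PZ]_z (h z)%:E <= M%:E ->
  \int[PZn]_s (\prod_(i < n) h (tnth s i))%:E <= (M ^+ n)%:E.
Proof.
move=> mh h0 hM.
have mhE : measurable_fun [set: Z] (EFin \o h) by exact/measurable_EFinP.
pose g := nnsfun_approx measurableT mhE.
have gh z : (g m z @[m --> \oo] --> h z)%R.
  have /fine_cvg// : (g m z)%:E @[m --> \oo] --> (h z)%:E.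
  by apply: (@cvg_nnsfun_approx _ _ _ _ measurableT _ mhE) => // x _; rewrite lee_fin.
have ndg m m' : (m <= m')%N -> forall z, (g m z <= g m' z)%R.
  by move=> mm z; exact/lefP/nd_nnsfun_approx.
have mtn i : measurable_fun [set: n.-tuple Z] (fun s => @tnth n Z s i).
  exact: measurable_tnth.
have mprod m : measurable_fun [set: n.-tuple Z]
    (fun s => (\prod_(i < n) g m (tnth s i))%:E).
  apply/measurable_EFinP; apply: measurable_prod => i _.
  exact: (measurableT_comp _ (mtn i)).
have ndprod m m' (s : n.-tuple Z) : (m <= m')%N ->
    (\prod_(i < n) g m (tnth s i) <= \prod_(i < n) g m' (tnth s i))%R.
  by move=> mm; apply: ler_prod => i _; rewrite ndg// andbT.
rewrite (_ : (fun s => _) = (fun s : n.-tuple Z =>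
    limn (fun m => (\prod_(i < n) g m (tnth s i))%:E))); last first.
  apply/funext => s; apply/esym/cvg_lim => //; apply: cvg_EFin; first exact: nearW.
  by apply: cvg_big; [exact: mul_continuous|move=> i _; exact: gh].
rewrite monotone_convergence//; last 2 first.
- by move=> m s _; rewrite lee_fin prodr_ge0.
- by move=> s _ m m' mm; rewrite lee_fin ndprod.
apply: lime_le.
  apply: ereal_nondecreasing_is_cvgn => m m' mm; apply: ge0_le_integral => //.
  - by move=> s _; rewrite lee_fin prodr_ge0.
  - by move=> s _; rewrite lee_fin ndprod.
apply: nearW => m; rewrite integral_prod_nnsfun lee_fin.
have gM : \int[PZ]_z (g m z)%:E <= M%:E.
  apply: le_trans hM; apply: ge0_le_integral => //.
  - by move=> z _; rewrite lee_fin.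
  - exact/measurable_EFinP.
  - move=> z _; rewrite lee_fin -(cvg_lim _ (gh z))//.
    apply: nondecreasing_cvgn_le; first by move=> p q pq; exact: ndg.
    by apply/cvg_ex; exists (h z); exact: gh.
have g0 : 0 <= \int[PZ]_z (g m z)%:E by apply: integral_ge0 => z _; rewrite lee_fin.
apply: lerXn2r.
- by rewrite nnegrE fine_ge0.
- by rewrite nnegrE -lee_fin (le_trans g0).
- rewrite -lee_fin fineK// ge0_fin_numE//; exact: le_lt_trans gM (ltry _).
Qed.

End product_prob.

(** * The joint law as a probability measure *)

Section measure_probability.
Context d (T : measurableType d) (R : realType) (mu : {measure set T -> \bar R})
  (mu1 : mu [set: T] = 1).

(** The proof of total mass one is an argument so that a probability structure can be attached to
    this alias; it serves for the kernel values [PWt S] and [chan (chan_id R dd)]. *)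
Definition measure_probability of mu [set: T] = 1 : set T -> \bar R := mu.

HB.instance Definition _ := isMeasure.Build _ _ _ (measure_probability mu1)
  (measure0 mu) (measure_ge0 mu) (@measure_semi_sigma_additive _ _ _ mu).

HB.instance Definition _ :=
  Measure_isProbability.Build _ _ _ (measure_probability mu1) mu1.

End measure_probability.

(** [P] is the image of the product of [PWt S] and [chan (chan_id R dd)] under [phi], which pairs
    the deployed weights with the trained ones. The integral formula is Tonelli's theorem;
    indicators give the first claim, and the two risks are later read off from it. *)
Lemma joint_dist_probability (R : realType) (dt : measure_display)
    (Wt : measurableType dt) (dZ : measure_display) (Z : measurableType dZ)
    (n dd : nat) (PWt : R.-pker (n.-tuple Z) ~> Wt)
    (chan : R.-pker (chan_space R dd) ~> (chan_space R dd)) (S : n.-tuple Z) :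
  exists P : probability (wspace Wt R dd * wspace Wt R dd)%type R,
    (forall A, measurable A -> joint_dist PWt chan S A = P A) /\
    (forall F, measurable_fun setT F -> (forall p, 0 <= F p) ->
      \int[P]_p F p = \int[PWt S]_wt \int[chan (chan_id R dd)]_c
                        F ((wt, c), (wt, chan_id R dd))).
Proof.
pose m1 : probability Wt R :=
  measure_probability _ _ _ _ (@prob_kernel _ _ _ _ _ PWt S).
pose m2 : probability (chan_space R dd) R :=
  measure_probability _ _ _ _ (@prob_kernel _ _ _ _ _ chan (chan_id R dd)).
pose phi (x : wspace Wt R dd) : wspace Wt R dd * wspace Wt R dd :=
  (x, (x.1, chan_id R dd)).
have mphi : measurable_fun [set: wspace Wt R dd] phi.
  by apply: measurable_fun_pair => //; exact: measurable_fun_pair.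
pose X : {mfun _ >-> _} := HB.pack phi (isMeasurableFun.Build _ _ _ _ _ mphi).
pose P : probability _ R := distribution (m1 \x m2)%E X.
have PF F : measurable_fun setT F -> (forall p, 0 <= F p) ->
      \int[P]_p F p = \int[PWt S]_wt \int[chan (chan_id R dd)]_c
                        F ((wt, c), (wt, chan_id R dd)).
  move=> mF F0; rewrite ge0_integral_pushforward//= preimage_setT.
  by rewrite fubini_tonelli1//; exact: measurableT_comp.
exists P; split => // A mA.
transitivity (\int[P]_p (\1_A p : R)%:E); last by rewrite integral_indic// setIT.
by rewrite PF//; exact/measurable_EFinP/measurable_indic.
Qed.

(** * Exponential moments and the high-probability event *)

Lemma eln_le_expR (R : realType) (x : \bar R) (c : R) :
  eln x <= c%:E -> x <= (expR c)%:E.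
Proof.
case: x => [r| |]//=; last by move=> _; rewrite leNye.
rewrite !lee_fin => rc; have [r0|r0] := leP r 0%R.
  (* For nonpositive [r] the value of [ln r] carries no information; positivity of [expR]
     suffices. *)
  exact: le_trans r0 (expR_ge0 _).
by rewrite -[leLHS]lnK ?posrE// ler_expR.
Qed.

(** Tonelli bounds the [P]-integral of [Phi] by [C], so Markov's inequality gives probability at
    most [eps] to [Phi] reaching [C / eps]; [A] is the complement. Subtracting [ln (C / eps)]
    normalizes the moment to 1, as [density_variational] requires. *)
Lemma markov_section d1 d2 (T : measurableType d1) (U : measurableType d2)
    (R : realType) (P : probability T R) (Q : probability U R)
    (H : T * U -> R) (C eps : R) :
  measurable_fun [set: T * U] H -> (0 < C)%R -> (0 < eps)%R ->
  \int[Q]_u \int[P]_t (expR (H (t, u)))%:E <= C%:E ->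
  exists A : set T, [/\ measurable A, (1 - eps)%:E <= P A &
    forall t, A t -> \int[Q]_u (expR (H (t, u) - ln (C / eps)))%:E <= 1].
Proof.
move=> mH C0 eps0 HC.
have ce0 : (0 < C / eps)%R by rewrite divr_gt0.
pose F (x : T * U) := (expR (H x))%:E.
have mF : measurable_fun [set: T * U] F.
  by apply/measurable_EFinP; exact: measurableT_comp.
have F0 x : 0 <= F x by rewrite lee_fin expR_ge0.
pose Phi t := \int[Q]_u F (t, u).
have mPhi : measurable_fun [set: T] Phi := measurable_fun_fubini_tonelli_F F mF F0.
have Phi0 t : 0 <= Phi t by exact: integral_ge0.
pose B := [set: T] `&` [set t | (C / eps)%:E <= `|Phi t|].
have mB : measurable B.
  by apply: emeasurable_fun_c_infty => //; exact: measurableT_comp.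
have PB : P B <= eps%:E.
  have := le_integral_abse P measurableT mPhi ce0.
  under eq_integral do rewrite gee0_abs//.
  rewrite (fubini_tonelli F)// => /le_trans /(_ HC).
  rewrite -lee_pdivlMl// => /le_trans; apply.
  by rewrite -EFinM lee_fin invf_div divfK// gt_eqF.
exists (~` B); split; first exact: measurableC.
  by rewrite probability_setC// EFinB; exact: leeB.
move=> t; rewrite /B setTI /= => /negP; rewrite -ltNge gee0_abs// => PhiC.
under eq_integral do rewrite expRB lnK ?posrE// EFinM.
rewrite ge0_integralZr//.
- move: PhiC; rewrite /Phi /F => /ltW PhiC.
  apply: (@le_trans _ _ ((C / eps)%:E * (C / eps)^-1%:E)).
    by apply: lee_wpmul2r => //; rewrite lee_fin invr_ge0 ltW.
  by rewrite -EFinM mulfV// gt_eqF.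
- exact: (measurableT_comp mF (measurable_pair1 t)).
- by rewrite lee_fin invr_ge0 ltW.
Qed.

Lemma subgaussian_mgf_le (R : realType) (dZ : measure_display)
    (Z : measurableType dZ) (PZ : probability Z R) (n : nat)
    (PZn : probability (n.-tuple Z) R) (W : Type) (loss : W -> Z -> R)
    (sigma k : R) (w : W) :
  (0 < n)%N -> is_product_prob PZ PZn -> measurable_fun [set: Z] (loss w) ->
  subgaussian_loss PZ loss sigma ->
  \int[PZn]_S (expR (k * (fine (poprisk PZ loss w) -
                          fine (emprisk loss S w))))%:E
    <= (expR (k ^+ 2 * sigma ^+ 2 / (2 * n%:R)))%:E.
Proof.
move=> n0 hPZn mloss hsg.
have nR : n%:R != 0%R :> R by rewrite pnatr_eq0 -lt0n.
pose L := fine (poprisk PZ loss w).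
(* The parameter is [- k / n]: the empirical risk enters negatively and averages [n] samples. The
   [n] factors together give the exponent [n * (k / n)^2 * sigma^2 / 2]. *)
have [_ /(_ (- (k / n%:R))%R) /eln_le_expR hM] := hsg w.
pose h z := expR (- (k / n%:R) * (loss w z - L)).
have mh : measurable_fun [set: Z] h.
  apply: measurableT_comp => //; apply: measurable_funM => //.
  exact: measurable_funB.
have h0 z : (0 <= h z)%R by exact: expR_ge0.
have := integral_prod_le _ _ _ _ _ _ hPZn _ _ mh h0 hM.
rewrite -expRM_natl; congr (_ <= _); last first.
  by congr ((expR _)%:E); field.
apply: eq_integral => S _; congr (_%:E); rewrite /h -expR_sum.
congr expR; rewrite -mulr_sumr sumrB sumr_const card_ord /= -/L -mulr_natl.
by field.
Qed.

(** * Infinite values of the bound, and the theorem *)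

Lemma KL_gtNy d (T : measurableType d) (R : realType)
    (m : set T -> \bar R) (P Q : probability T R) :
  (forall A, measurable A -> m A = P A) -> -oo < KL m Q.
Proof.
move=> /(KL_density _ _ _ _ _ Q) [->|[f fPQ ->]]; first by [].
exact: density_ln_gtNy fPQ.
Qed.

(** Disposes of an infinite divergence or exponential moment. Both terms must differ from [-oo],
    which would absorb [+oo] in a sum. *)
Lemma bound_pinfty (R : realType) (a b k : R) (x y : \bar R) :
  (0 < k)%R -> -oo < x -> -oo < y -> x = +oo \/ y = +oo ->
  a%:E + (x - b%:E) * (k^-1)%:E + (k^-1)%:E * y = +oo.
Proof.
move=> k0; have k1 : 0 < (k^-1)%:E by rewrite lte_fin invr_gt0.
by case: x y => [x| |] [y| |]// _ _ [|]// _;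
  rewrite /= ?gt0_mulye ?gt0_muley//= ?addye ?addey.
Qed.

Theorem theorem1
  (R : realType) (dZ : measure_display) (Z : measurableType dZ)
  (PZ : probability Z R) (n : nat) (hn : (0 < n)%N)
  (PZn : probability (n.-tuple Z) R) (hPZn : is_product_prob PZ PZn)
  (dt : measure_display) (Wt : measurableType dt) (dd : nat)
  (PWt : R.-pker (n.-tuple Z) ~> Wt)
  (chan : R.-pker (chan_space R dd) ~> (chan_space R dd))
  (met_t : Wt -> Wt -> R) (met_c : chan_space R dd -> chan_space R dd -> R)
  (hmet_t : is_metric met_t) (hmet_c : is_metric met_c)
  (hmmet_t : measurable_fun [set: (Wt * Wt)%type] (fun p => met_t p.1 p.2))
  (hmmet_c : measurable_fun [set: (chan_space R dd * chan_space R dd)%type]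
               (fun p => met_c p.1 p.2))
  (loss : wspace Wt R dd -> Z -> R)
  (hloss0 : forall w z, (0 <= loss w z)%R)
  (hlossm : measurable_fun [set: (wspace Wt R dd * Z)%type] (fun p => loss p.1 p.2))
  (sigma K : R)
  (hsg : subgaussian_loss PZ loss sigma)
  (hlip : lipschitz_loss loss (wmetric met_t met_c) K)
  (Q : probability (wspace Wt R dd * wspace Wt R dd)%type R)
  (k eps : R) (hk : (0 < k)%R) (heps0 : (0 < eps)%R) (heps1 : (eps < 1)%R) :
  exists A : set (n.-tuple Z),
    [/\ measurable A, (1 - eps)%:E <= PZn A &
      forall S, A S ->
        deployed_risk PWt chan PZ loss S - training_risk PWt loss S
        <= (k * sigma ^+ 2 / (2 * n%:R))%:E
           + (KL (joint_dist PWt chan S) Q - (ln eps)%:E) * (k^-1)%:E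
           + (k^-1)%:E *
             eln (\int[Q]_p (expR (k * K * wmetric met_t met_c p.1 p.2))%:E)].
Proof.
have nR : n%:R != 0%R :> R by rewrite pnatr_eq0 -lt0n.
pose L w := fine (poprisk PZ loss w).
pose Lh (S : n.-tuple Z) w := fine (emprisk loss S w).
pose dW (p : wspace Wt R dd * wspace Wt R dd) := wmetric met_t met_c p.1 p.2.
have popE w : poprisk PZ loss w = (L w)%:E.
  by rewrite fineK//; apply: integrable_fin_num => //; exact: (hsg w).1.
have L0 w : (0 <= L w)%R.
  by apply: fine_ge0; apply: integral_ge0 => z _; rewrite lee_fin.
have Lh0 S w : (0 <= Lh S w)%R by rewrite mulr_ge0// sumr_ge0.
have mL : measurable_fun [set: wspace Wt R dd] L.
  apply: measurableT_comp => //.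
  apply: (measurable_fun_fubini_tonelli_F
    (fun x : wspace Wt R dd * Z => (loss x.1 x.2)%:E)).
    exact/measurable_EFinP.
  by move=> x; rewrite lee_fin.
have mLh : measurable_fun [set: n.-tuple Z * wspace Wt R dd]
    (fun x => Lh x.1 x.2).
  apply: measurable_funM => //; apply: measurable_sum => i.
  apply: (measurableT_comp (f := fun p : wspace Wt R dd * Z => loss p.1 p.2)
    (g := fun x : n.-tuple Z * wspace Wt R dd => (x.2, tnth x.1 i))) => //.
  apply: measurable_fun_pair => //.
  exact: (measurableT_comp (measurable_tnth i)).
have mdW : measurable_fun setT dW.
  apply: measurable_funD.
    apply: (measurableT_comp (f := fun p : Wt * Wt => met_t p.1 p.2)
      (g := fun p : wspace Wt R dd * wspace Wt R dd => (p.1.1, p.2.1))) => //.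
    by apply: measurable_fun_pair; exact: measurableT_comp.
  apply: (measurableT_comp
    (f := fun p : chan_space R dd * chan_space R dd => met_c p.1 p.2)
    (g := fun p : wspace Wt R dd * wspace Wt R dd => (p.1.2, p.2.2))) => //.
  by apply: measurable_fun_pair; exact: measurableT_comp.
(* The two risks stay separate so that [H] has the shape [a - b] of [density_variational]. *)
pose H (x : n.-tuple Z * (wspace Wt R dd * wspace Wt R dd)) :=
  (k * L x.2.1 - k * Lh x.1 x.2.2)%R.
have mH : measurable_fun setT H.
  apply: measurable_funB; apply: measurable_funM => //.
    by apply: (measurableT_comp mL); exact: measurableT_comp.
  apply: (measurableT_comp mLh (g := fun x :
    n.-tuple Z * (wspace Wt R dd * wspace Wt R dd) => (x.1, x.2.2))).
  by apply: measurable_fun_pair => //; exact: measurableT_comp.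
have H_le S p : (H (S, p) <= k * (L p.1 - Lh S p.1) + k * K * dW p)%R.
  have LhB : (Lh S p.1 - Lh S p.2 <= K * dW p)%R.
    rewrite /Lh /emprisk /= -mulrBr -sumrB.
    apply: (@le_trans _ _ (n%:R^-1 * \sum_(i < n) (K * dW p))%R).
      apply: ler_wpM2l => //; apply: ler_sum => i _.
      exact: le_trans (ler_norm _) (hlip _ _ _).
    by rewrite sumr_const card_ord -[X in (_ * X <= _)%R]mulr_natl mulKf.
  have := ler_wpM2l (ltW hk) LhB; rewrite /H /=; lra.
have mexp : measurable_fun setT (fun p => expR (k * K * dW p)).
  by apply: measurableT_comp => //; exact: measurable_funM.
case EE : (\int[Q]_p (expR (k * K * wmetric met_t met_c p.1 p.2))%:E) => [E| |].
- have E0 : (0 < E)%R.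
    apply: lt_le_trans ltr01 _; rewrite -lee_fin -EE.
    rewrite -[leLHS](probability_setT Q) -[leLHS]mul1e -integral_cst//.
    apply: ge0_le_integral => //; first exact/measurable_EFinP.
    move=> p _; rewrite lee_fin -expR0 ler_expR -mulrA; apply: mulr_ge0.
      exact: ltW.
    (* The sign of [K * dW p] comes from the Lipschitz bound at one sample, where it dominates an
       absolute value. *)
    exact: le_trans (normr_ge0 _) (hlip point p.1 p.2).
  pose C := (expR (k ^+ 2 * sigma ^+ 2 / (2 * n%:R)) * E)%R.
  have C0 : (0 < C)%R by rewrite mulr_gt0// expR_gt0.
  have HC : \int[Q]_p \int[PZn]_S (expR (H (S, p)))%:E <= C%:E.
    have mHE : measurable_fun setT (fun x => (expR (H x))%:E).
      by apply/measurable_EFinP; exact: measurableT_comp.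
    rewrite /C EFinM -EE -ge0_integralZl_EFin//; last exact/measurable_EFinP.
    apply: ge0_le_integral => //.
    - by move=> p _; apply: integral_ge0 => S _; rewrite lee_fin expR_ge0.
    - exact: (measurable_fun_fubini_tonelli_G (fun x => (expR (H x))%:E) mHE).
    - by apply/measurable_EFinP; exact: measurable_funM.
    move=> p _.
    have mLhp : measurable_fun [set: n.-tuple Z]
        (fun S => (expR (k * (L p.1 - Lh S p.1)))%:E).
      apply/measurable_EFinP; apply: measurableT_comp => //.
      apply: measurable_funM => //; apply: measurable_funB => //.
      exact: (measurableT_comp mLh (measurable_pair2 p.1)).
    (* For fixed [p] the distance factor is constant in [S]; what remains is the moment of the gap
       at the single weight [p.1]. *)
    rewrite muleC; apply: (@le_trans _ _ ((expR (k * K * dW p))%:E *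
      \int[PZn]_S (expR (k * (L p.1 - Lh S p.1)))%:E)); last first.
      apply: lee_wpmul2l; first by rewrite lee_fin expR_ge0.
      apply: subgaussian_mgf_le => //.
      exact: (measurableT_comp hlossm (measurable_pair1 p.1)).
    rewrite -ge0_integralZl_EFin//.
    apply: ge0_le_integral => //.
    - exact: (measurableT_comp mHE (measurable_pair2 p)).
    - exact: measurable_funeM.
    - by move=> S _; rewrite -EFinM -expRD lee_fin ler_expR addrC.
  have [A [mA PA HA]] := markov_section _ _ _ _ _ _ _ _ _ _ mH C0 heps0 HC.
  exists A; split => // S /HA {}HA.
  have [P [jP PF]] := joint_dist_probability _ _ _ _ _ _ _ PWt chan S.
  rewrite [eln _]/=.
  have KLN := KL_gtNy _ _ _ _ _ Q jP.
  have [->|[f fPQ KLE]] := KL_density _ _ _ _ _ Q jP.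
    by rewrite bound_pinfty ?leey ?ltNyr//; left.
  rewrite KLE in KLN *.
  case IE : (\int[P]_x (ln (f x))%:E) KLN => [D| |]// _; last first.
    by rewrite bound_pinfty ?leey ?ltNyr//; left.
  have mL1 : measurable_fun setT (fun p : wspace Wt R dd * wspace Wt R dd => L p.1).
    exact: measurableT_comp.
  have mLh2 : measurable_fun setT
      (fun p : wspace Wt R dd * wspace Wt R dd => Lh S p.2).
    apply: (measurableT_comp (f := Lh S)) => //.
    exact: (measurableT_comp mLh (measurable_pair1 S)).
  have DRE : deployed_risk PWt chan PZ loss S = \int[P]_p (L p.1)%:E.
    rewrite PF; [|exact/measurable_EFinP|by move=> p; rewrite lee_fin].
    by apply: eq_integral => wt _; apply: eq_integral => c _; rewrite popE.
  have TRE : training_risk PWt loss S = \int[P]_p (Lh S p.2)%:E.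
    rewrite PF; [|exact/measurable_EFinP|by move=> p; rewrite lee_fin].
    apply: eq_integral => wt _ /=.
    by rewrite integral_cst//= prob_kernel mule1.
  have DR0 : 0 <= deployed_risk PWt chan PZ loss S.
    by rewrite DRE; apply: integral_ge0 => p _; rewrite lee_fin.
  have TR0 : 0 <= training_risk PWt loss S.
    by rewrite TRE; apply: integral_ge0 => p _; rewrite lee_fin.
  have [TRoo|TRoo] := eqVneq (training_risk PWt loss S) +oo.
    by rewrite TRoo addeNy leNye.
  have kL : \int[P]_p (k * L p.1)%:E = k%:E * deployed_risk PWt chan PZ loss S.
    rewrite DRE -ge0_integralZl_EFin ?ltW//; last exact/measurable_EFinP.
    by move=> p _; rewrite lee_fin.
  have kLh : \int[P]_p (k * Lh S p.2)%:E = k%:E * training_risk PWt loss S.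
    rewrite TRE -ge0_integralZl_EFin ?ltW//; last exact/measurable_EFinP.
    by move=> p _; rewrite lee_fin.
  (* Donsker-Varadhan with [a] the deployed term, [b] the training term and [c] the normalization
     [ln (C / eps)]. *)
  have := density_variational _ _ _ _ _ f (fun p => k * L p.1)%R
    (fun p => k * Lh S p.2)%R (ln (C / eps)) fPQ.
  rewrite IE ltry kL kLh => /(_ isT).
  case: (training_risk PWt loss S) TR0 TRoo => // t t0 _.
  rewrite -EFinM ltry => DV.
  have {DV} : k%:E * deployed_risk PWt chan PZ loss S <=
      (k * t)%:E + ((ln (C / eps))%:E + D%:E).
    apply: DV => //; [exact: measurable_funM|exact: measurable_funM| |].
    - by move=> p; rewrite mulr_ge0// ltW.
    - by move=> p; rewrite mulr_ge0// ltW.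
  (* An infinite deployed risk would contradict the finite right-hand side just obtained. *)
  case: (deployed_risk PWt chan PZ loss S) DR0 => // [d d0|_]; last first.
    by rewrite gt0_muley// lte_fin.
  rewrite -!EFinM -!EFinD !lee_fin.
  (* [ln (C / eps)] splits into the sub-Gaussian exponent, [ln E] and [- ln eps]; dividing by [k]
     yields the three terms of the bound. *)
  rewrite ln_div ?posrE// lnM ?posrE ?expR_gt0// expRK => DV.
  rewrite -(ler_pM2l hk); apply: le_trans (_ : _ <= _)%R.
    by rewrite mulrBr lerBlDl; exact: DV.
  by rewrite le_eqVlt; apply/orP; left; apply/eqP; field; rewrite gt_eqF// nR.
(* With an infinite exponential moment the bound is [+oo] for every sample. *)
- exists setT; split => //; first by rewrite probability_setT lee_fin; lra.
  move=> S _.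
  have [P [jP _]] := joint_dist_probability _ _ _ _ _ _ _ PWt chan S.
  rewrite bound_pinfty ?leey//; last by right.
  exact: KL_gtNy jP.
- have : 0 <= \int[Q]_p (expR (k * K * dW p))%:E.
    by apply: integral_ge0 => p _; rewrite lee_fin expR_ge0.
  by rewrite EE.
Qed.
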